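(* Let $n\ge1$. For every Dyck path $P$ of length $2n-2$, the set of the sons of $P$ forms a saturated chain in the lattice $\mathcal{D}_{n}$ of Dyck paths of length $2n$. Therefore the sets of sons of $P$, as $P$ ranges over all Dyck paths of length $2n-2$, form a partition of $\mathcal{D}_{n}$ into saturated chains.
   Context: For $m\ge0$, $\mathcal{D}_{m}$ is the set of Dyck paths of length $2m$, i.e. functions $f:[0,2m]\to\mathbf{N}$ (with $[0,2m]$ an interval of integers and $\mathbf{N}$ the nonnegative integers) such that $f(0)=f(2m)=0$ and $f(i+1)-f(i)\in\{-1,1\}$ for all $0\le i<2m$, ordered by $f\le g$ iff $f(i)\le g(i)$ for all $i$; it is a finite distributive lattice. A rise step is a step $+1$, a fall step is a step $-1$. The last descent of a Dyck path is its final maximal sequence of consecutive fall steps; let $k$ be its length ($k=0$ for the path of length $0$). The sons of a Dyck path $P$ of length $2n-2$ whose last descent has length $k$ are the $k+1$ Dyck paths of length $2n$ obtained by inserting a peak (a rise step immediately followed by a fall step) at one of the $k+1$ points of the last descent of $P$ (its two endpoints included). A chain (totally ordered subset) in a finite poset is saturated if each element of the chain other than its largest is covered in the poset by the next larger element of the chain. *)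

(* Defs.v *)
From HB Require Import structures.
From mathcomp Require Import all_boot all_order.
From mathcomp Require Import zify.

Set Implicit Arguments.
Unset Strict Implicit.
Unset Printing Implicit Defensive.

Import Order.TTheory.

(* A function on the integer interval [0, 2m] is an {ffun 'I_(m.*2.+1) -> nat};
   [ht f i] is its value at an index [i : nat] (meaningful for [i <= m.*2]). *)
Definition ht m (f : {ffun 'I_(m.*2.+1) -> nat}) (i : nat) : nat := f (inord i).

Definition rise_step (h : nat -> nat) (i : nat) : bool := h i.+1 == (h i).+1.
Definition fall_step (h : nat -> nat) (i : nat) : bool := h i == (h i.+1).+1.

Definition is_dyck m (f : {ffun 'I_(m.*2.+1) -> nat}) : bool :=
  [&& ht f 0 == 0, ht f m.*2 == 0
    & [forall i : 'I_(m.*2), rise_step (ht f) i || fall_step (ht f) i]].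

Record dyck (m : nat) := Dyck {
  dyck_fun :> {ffun 'I_(m.*2.+1) -> nat};
  dyckP : is_dyck dyck_fun
}.

HB.instance Definition _ m := [isSub for @dyck_fun m].
HB.instance Definition _ m := [Countable of dyck m by <:].

Lemma dyck_ht0 m (P : dyck m) : ht P 0 = 0.
Proof. by case/and3P: (dyckP P) => /eqP. Qed.

Lemma dyck_htn m (P : dyck m) : ht P m.*2 = 0.
Proof. by case/and3P: (dyckP P) => _ /eqP. Qed.

Lemma dyck_step m (P : dyck m) i : i < m.*2 ->
  rise_step (ht P) i || fall_step (ht P) i.
Proof. by case/and3P: (dyckP P) => _ _ /forallP H lti; exact: (H (Ordinal lti)). Qed.

Lemma htE m (f : {ffun 'I_(m.*2.+1) -> nat}) (i : 'I_(m.*2.+1)) : ht f i = f i.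
Proof. by rewrite /ht inord_val. Qed.

Lemma ht_ffun m (g : nat -> nat) i : i <= m.*2 ->
  ht [ffun j : 'I_(m.*2.+1) => g j] i = g i.
Proof. by move=> lei; rewrite /ht ffunE inordK. Qed.

Lemma is_dyck_ffun m (g : nat -> nat) :
  g 0 = 0 -> g m.*2 = 0 ->
  (forall i, i < m.*2 -> rise_step g i || fall_step g i) ->
  is_dyck [ffun j : 'I_(m.*2.+1) => g j].
Proof.
move=> g0 gn gs; apply/and3P; split; rewrite ?ht_ffun ?g0 ?gn //.
apply/forallP=> i; rewrite /rise_step /fall_step !ht_ffun ?gs //; exact: ltnW.
Qed.

Lemma dyck_ht_le m (P : dyck m) i : i <= m.*2 -> ht P i <= i.
Proof.
elim: i => [|i IHi] lei; first by rewrite dyck_ht0.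
move: (IHi (ltnW lei)) (dyck_step P lei); rewrite /rise_step /fall_step; lia.
Qed.

Lemma dyck_odd m (P : dyck m) i : i <= m.*2 -> odd (ht P i) = odd i.
Proof.
elim: i => [|i IHi] lei; first by rewrite dyck_ht0.
move: (IHi (ltnW lei)) (dyck_step P lei); rewrite /rise_step /fall_step; lia.
Qed.

Lemma dyck_bound m (P : dyck m) (i : 'I_(m.*2.+1)) : P i < m.*2.+1.
Proof.
have lei : i <= m.*2 by rewrite -ltnS.
by rewrite ltnS -htE (leq_trans (dyck_ht_le P lei)).
Qed.

Definition dyck_code m (P : dyck m) : {ffun 'I_(m.*2.+1) -> 'I_(m.*2.+1)} :=
  [ffun i => Ordinal (dyck_bound P i)].

Definition dyck_decode m (c : {ffun 'I_(m.*2.+1) -> 'I_(m.*2.+1)}) :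
    option (dyck m) := insub [ffun i => c i : nat].

Lemma dyck_codeK m : pcancel (@dyck_code m) (@dyck_decode m).
Proof.
move=> P; rewrite /dyck_decode (_ : [ffun _ => _] = P) ?valK //.
by apply/ffunP=> i; rewrite !ffunE.
Qed.

HB.instance Definition _ m : isFinite (dyck m) := PCanIsFinite (@dyck_codeK m).

Section DyckLattice.
Variable m : nat.
Implicit Types P Q T : dyck m.

Definition dyck_le P Q : bool := [forall i, P i <= Q i].
Definition dyck_lt P Q : bool := (Q != P) && dyck_le P Q.

(* Two Dyck paths have the same parity at each abscissa, hence cannot cross
   without meeting at an integer abscissa. *)
Lemma dyck_minP P Q :
  is_dyck [ffun i : 'I_(m.*2.+1) => minn (ht P i) (ht Q i)].
Proof.
apply: (@is_dyck_ffun m (fun i => minn (ht P i) (ht Q i))).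
- by rewrite !dyck_ht0.
- by rewrite !dyck_htn.
move=> i lti; move: (dyck_step P lti) (dyck_step Q lti).
move: (dyck_odd P (ltnW lti)) (dyck_odd Q (ltnW lti)).
rewrite /rise_step /fall_step; lia.
Qed.

Lemma dyck_maxP P Q :
  is_dyck [ffun i : 'I_(m.*2.+1) => maxn (ht P i) (ht Q i)].
Proof.
apply: (@is_dyck_ffun m (fun i => maxn (ht P i) (ht Q i))).
- by rewrite !dyck_ht0.
- by rewrite !dyck_htn.
move=> i lti; move: (dyck_step P lti) (dyck_step Q lti).
move: (dyck_odd P (ltnW lti)) (dyck_odd Q (ltnW lti)).
rewrite /rise_step /fall_step; lia.
Qed.

Definition dyck_meet P Q := Dyck (dyck_minP P Q).
Definition dyck_join P Q := Dyck (dyck_maxP P Q).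

Lemma dyck_meetE P Q i : dyck_meet P Q i = minn (P i) (Q i).
Proof. by rewrite ffunE !htE. Qed.

Lemma dyck_joinE P Q i : dyck_join P Q i = maxn (P i) (Q i).
Proof. by rewrite ffunE !htE. Qed.

Lemma dyck_eqP P Q : (forall i, P i = Q i) -> P = Q.
Proof. by move=> eqPQ; apply/val_inj/ffunP. Qed.

Fact dyck_le_def P Q : dyck_le P Q = (dyck_meet P Q == P).
Proof.
apply/forallP/eqP => [lePQ | <- i]; last by rewrite dyck_meetE geq_minr.
by apply: dyck_eqP => i; rewrite dyck_meetE; apply/minn_idPl.
Qed.

Fact dyck_lt_def P Q : dyck_lt P Q = (Q != P) && dyck_le P Q.
Proof. by []. Qed.

Fact dyck_meetC : commutative dyck_meet.
Proof. by move=> P Q; apply: dyck_eqP => i; rewrite !dyck_meetE minnC. Qed.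

Fact dyck_joinC : commutative dyck_join.
Proof. by move=> P Q; apply: dyck_eqP => i; rewrite !dyck_joinE maxnC. Qed.

Fact dyck_meetA : associative dyck_meet.
Proof. by move=> P Q T; apply: dyck_eqP => i; rewrite !dyck_meetE minnA. Qed.

Fact dyck_joinA : associative dyck_join.
Proof. by move=> P Q T; apply: dyck_eqP => i; rewrite !dyck_joinE maxnA. Qed.

Fact dyck_joinKI Q P : dyck_meet P (dyck_join P Q) = P.
Proof. by apply: dyck_eqP => i; rewrite dyck_meetE dyck_joinE maxnC maxKn. Qed.

Fact dyck_meetKU Q P : dyck_join P (dyck_meet P Q) = P.
Proof. by apply: dyck_eqP => i; rewrite dyck_joinE dyck_meetE minnC minKn. Qed.

Fact dyck_meetUl : left_distributive dyck_meet dyck_join.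
Proof.
by move=> P Q T; apply: dyck_eqP => i; rewrite !(dyck_meetE, dyck_joinE) minn_maxl.
Qed.

Fact dyck_meetxx : idempotent_op dyck_meet.
Proof. by move=> P; apply: dyck_eqP => i; rewrite dyck_meetE minnn. Qed.

End DyckLattice.

Fact dyck_display : Order.disp_t. Proof. exact: (Order.Disp tt tt). Qed.

HB.instance Definition _ m :=
  Order.isMeetJoinDistrLattice.Build dyck_display (dyck m)
    (@dyck_le_def m) (@dyck_lt_def m)
    (@dyck_meetC m) (@dyck_joinC m) (@dyck_meetA m) (@dyck_joinA m)
    (@dyck_joinKI m) (@dyck_meetKU m) (@dyck_meetUl m) (@dyck_meetxx m).

Lemma dyck_leE m (P Q : dyck m) : (P <= Q)%O = [forall i, P i <= Q i].
Proof. by []. Qed.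

(* Each point of a path is identified with its abscissa; [k] is the length of
   a final run of fall steps iff the steps numbered from [m.*2 - k] all fall. *)

Definition last_descent_length m (P : dyck m) : nat :=
  \max_(k < m.*2.+1
         | [forall i : 'I_(m.*2), (m.*2 - k <= i) ==> fall_step (ht P) i]) k.

Definition last_descent_points m (P : dyck m) : {set 'I_(m.*2.+1)} :=
  [set j : 'I_(m.*2.+1) | m.*2 - last_descent_length P <= j].

(* The height function obtained from [h] by inserting a peak at abscissa [j]. *)
Definition insert_peak_fun (h : nat -> nat) (j i : nat) : nat :=
  if i <= j then h i else if i == j.+1 then (h j).+1 else h (i - 2).

Lemma insert_peakP m (P : dyck m) (j : 'I_(m.*2.+1)) :
  is_dyck [ffun i : 'I_(m.+1.*2.+1) => insert_peak_fun (ht P) j i].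
Proof.
have lej : j <= m.*2 by rewrite -ltnS.
apply: (@is_dyck_ffun m.+1 (insert_peak_fun (ht P) j)); rewrite /insert_peak_fun.
- by rewrite leq0n dyck_ht0.
- have -> : (m.+1.*2 <= j) = false by lia.
  have -> : (m.+1.*2 == j.+1) = false by lia.
  by rewrite doubleS subn2 dyck_htn.
move=> i; rewrite doubleS => lti; rewrite /rise_step /fall_step eqSS.
have [ltij|ltji|->] := ltngtP i j; last by rewrite eqxx.
  by apply: (dyck_step P); lia.
have [-> | neij] := eqVneq i j.+1; first by rewrite subn2 /= eqxx orbT.
have -> : i.+1 - 2 = (i - 2).+1 by lia.
by apply: (dyck_step P); lia.
Qed.

Definition insert_peak m (P : dyck m) (j : 'I_(m.*2.+1)) : dyck m.+1 :=
  Dyck (insert_peakP P j).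

Definition sons m (P : dyck m) : {set dyck m.+1} :=
  [set insert_peak P j | j in last_descent_points P].

Section SaturatedChains.
Context {d : Order.disp_t} {T : finPOrderType d}.
Implicit Types (A : {set T}) (x y : T).

Definition is_chain A : bool := [forall x in A, forall y in A, (x >=< y)%O].

Definition next_in A x y : bool :=
  [&& x \in A, y \in A, (x < y)%O & ~~ [exists z in A, (x < z)%O && (z < y)%O]].

Definition covered_by x y : bool :=
  (x < y)%O && ~~ [exists z, (x < z)%O && (z < y)%O].

(* In a finite chain, [y] with [next_in A x y] exists iff [x] is not the largest
   element of [A], so no separate case for the largest element is needed. *)
Definition saturated_chain A : bool :=
  is_chain A && [forall x, forall y, next_in A x y ==> covered_by x y].

End SaturatedChains.

(* Main.v *)
(* A point of abscissa j lies on the last descent of a Dyck path of length 2m iff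
   its height is 2m - j, the largest height allowed by the return to 0.  The son
   of P with peak inserted there is thus P up to j, followed by one rise and then
   by falls only.  Hence j is recovered as the abscissa of the last rise of the
   son, P is obtained by deleting the last peak, and two sons with consecutive
   insertion points differ at a single abscissa, by 2; since heights have a fixed
   parity, nothing lies strictly between them. *)
Require Import Defs.
From mathcomp Require Import all_boot all_order.
From mathcomp Require Import zify.

Set Implicit Arguments.
Unset Strict Implicit.
Unset Printing Implicit Defensive.

Import Order.TTheory.

(** * Heights of Dyck paths and the last descent *)

Lemma dyck_htP m (P Q : dyck m) :
  (forall i, i <= m.*2 -> ht P i = ht Q i) -> P = Q.
Proof.
move=> eqPQ; apply: dyck_eqP => i; rewrite -!htE; apply: eqPQ.
by rewrite -ltnS.
Qed.

Lemma dyck_leP m (P Q : dyck m) :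
  reflect (forall i, i <= m.*2 -> ht P i <= ht Q i) (P <= Q)%O.
Proof.
rewrite dyck_leE; apply: (iffP forallP) => lePQ i; first by move=> _; exact: lePQ.
by rewrite -!htE; apply: lePQ; rewrite -ltnS.
Qed.

Lemma dyck_ht_drop m (P : dyck m) i j :
  i <= j <= m.*2 -> ht P i <= ht P j + (j - i).
Proof.
elim: j => [|j IHj] /andP[leij lejm]; first by (have -> : i = 0 by lia); lia.
have [-> | neij] := eqVneq i j.+1; first by lia.
have := IHj ltac:(lia); have := dyck_step P lejm.
by rewrite /rise_step /fall_step; lia.
Qed.

Lemma dyck_ht_le_rev m (P : dyck m) i : i <= m.*2 -> ht P i <= m.*2 - i.
Proof. by move=> lei; have := @dyck_ht_drop m P i m.*2; rewrite dyck_htn; lia. Qed.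

(** A path falls by at most one per step from [j], and the return to 0 caps its height at
    [m.*2 - i]; the two bounds meet. *)
Lemma dyck_descent_ht m (P : dyck m) i j :
  j <= i <= m.*2 -> ht P j = m.*2 - j -> ht P i = m.*2 - i.
Proof.
move=> /andP[leji leim] htj.
have := @dyck_ht_drop m P j i; have := dyck_ht_le_rev P leim; lia.
Qed.

(** Trades the maximum defining the last descent for a test on one height. *)
Lemma mem_last_descent_points m (P : dyck m) (j : 'I_(m.*2.+1)) :
  (j \in last_descent_points P) = (ht P j == m.*2 - j).
Proof.
have lej : j <= m.*2 by rewrite -ltnS.
rewrite inE /last_descent_length; apply/idP/eqP => [|htj].
  set A := fun k : 'I_(m.*2.+1) =>
    [forall i : 'I_(m.*2), (m.*2 - k <= i) ==> fall_step (ht P) i].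
  (* The empty run qualifies vacuously, so the maximum is attained by some run length [k]. *)
  have A0 : 0 < #|A|.
    apply/card_gt0P; exists ord0; apply/forallP=> i.
    by have := ltn_ord i; rewrite subn0; lia.
  have [k /forallP Ak ->] := eq_bigmax_cond (fun k : 'I_(m.*2.+1) => k : nat) A0.
  move=> lekj.
  suff descent t : t <= m.*2 - j -> ht P (m.*2 - t) = t.
    by have := descent (m.*2 - j) (leqnn _); rewrite subKn.
  elim: t => [|t IHt] letj; first by rewrite subn0 dyck_htn.
  have ltm : m.*2 - t.+1 < m.*2 by lia.
  have /implyP/= := Ak (Ordinal ltm); move/(_ ltac:(lia)).
  have -> : m.*2 - t.+1 = (m.*2 - t).-1 by lia.
  rewrite /fall_step prednK; last by lia.
  by rewrite IHt ?(ltnW letj) // => /eqP.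
(* Conversely, every step from [j] on falls, so [m.*2 - j] is one of the run lengths under the
   maximum. *)
have ltk : m.*2 - j < m.*2.+1 by lia.
rewrite leq_subCl -[X in X <= _]/(nat_of_ord (Ordinal ltk)).
apply: (@leq_bigmax_cond _ _ (fun k : 'I_(m.*2.+1) => k : nat)).
apply/forallP=> i; apply/implyP=> /= lei; have ltim := ltn_ord i.
rewrite /fall_step (dyck_descent_ht (i := i) _ htj); last by lia.
by rewrite (dyck_descent_ht (i := i.+1) _ htj); lia.
Qed.

(** * The order on the sons of a path *)

Lemma ht_insert_peak m (P : dyck m) (j : 'I_(m.*2.+1)) i : i <= m.+1.*2 ->
  ht (insert_peak P j) i = insert_peak_fun (ht P) j i.
Proof. by move=> lei; rewrite ht_ffun. Qed.

Lemma ht_son m (P : dyck m) (j : 'I_(m.*2.+1)) i :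
  j \in last_descent_points P -> i <= m.+1.*2 ->
  ht (insert_peak P j) i = if i <= j then ht P i else m.+1.*2 - i.
Proof.
rewrite mem_last_descent_points => /eqP htj lei; rewrite ht_insert_peak //.
have := ltn_ord j; rewrite /insert_peak_fun; case: (leqP i j) => // ltji ltjm.
have [-> | neij] := eqVneq i j.+1; first by lia.
by rewrite (dyck_descent_ht (j := j)) //; lia.
Qed.

(** After its insertion point a son runs on the line [m.+1.*2 - i], which lies above [P]; an earlier
    insertion reaches this line sooner and gives a higher path. *)
Lemma insert_peak_le m (P : dyck m) (j j' : 'I_(m.*2.+1)) :
  j \in last_descent_points P -> j' \in last_descent_points P ->
  (insert_peak P j <= insert_peak P j')%O = (j' <= j).
Proof.
move=> Pj Pj'; have := ltn_ord j; have := ltn_ord j' => ltj' ltj.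
apply/dyck_leP/idP => [le_sons | lej'j i lei].
  have lej : j.+1 <= m.+1.*2 by lia.
  have := le_sons _ lej; rewrite !ht_son // ltnn.
  have := @dyck_ht_le_rev m P j.+1.
  by case: (leqP j.+1 j'); lia.
rewrite !ht_son //; have := @dyck_ht_le_rev m P i.
by case: (leqP i j); case: (leqP i j'); lia.
Qed.

Lemma insert_peak_lt m (P : dyck m) (j j' : 'I_(m.*2.+1)) :
  j \in last_descent_points P -> j' \in last_descent_points P ->
  (insert_peak P j < insert_peak P j')%O = (j' < j).
Proof. by move=> Pj Pj'; rewrite lt_leAnge !insert_peak_le //; lia. Qed.

Lemma insert_peak_covered m (P : dyck m) (j j' : 'I_(m.*2.+1)) :
  j \in last_descent_points P -> j' \in last_descent_points P -> j' = j.+1 :> nat ->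
  covered_by (insert_peak P j') (insert_peak P j).
Proof.
move=> Pj Pj' def_j'; rewrite /covered_by insert_peak_lt // def_j' leqnn /=.
apply/existsPn=> Z; apply/negP; rewrite !lt_leAnge.
case/andP=> /andP[/dyck_leP leZ nZle] /andP[/dyck_leP Zle nleZ].
have ltj' := ltn_ord j'.
have htPj' : ht P j.+1 = m.*2 - j.+1.
  by move: Pj'; rewrite mem_last_descent_points def_j' => /eqP.
have sonsE i : i <= m.+1.*2 -> i != j.+1 ->
    ht (insert_peak P j') i = ht (insert_peak P j) i.
  move=> lei nei; rewrite !ht_son //; have := @dyck_ht_le_rev m P i.
  by case: (leqP i j); case: (leqP i j'); lia.
have ZE i : i <= m.+1.*2 -> i != j.+1 ->
    ht Z i = ht (insert_peak P j) i.
  by move=> lei nei; have := leZ i lei; have := Zle i lei; rewrite sonsE //; lia.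
have lej1 : j.+1 <= m.+1.*2 by lia.
have oddZ := dyck_odd Z lej1.
have := leZ _ lej1; have := Zle _ lej1; rewrite !ht_son // ltnn def_j' leqnn htPj'.
move=> leZj geZj.
(* The two bounds on [ht Z j.+1] differ by 2, and [oddZ] excludes the value between them. *)
have [htZ | htZ] : ht Z j.+1 = m.*2 - j.+1 \/ ht Z j.+1 = m.+1.*2 - j.+1 by lia.
- case/negP: nZle; apply/dyck_leP => i lei.
  have [-> | nei] := eqVneq i j.+1; last by rewrite ZE // sonsE.
  by rewrite htZ ht_son // def_j' leqnn htPj'.
case/negP: nleZ; apply/dyck_leP => i lei.
have [-> | nei] := eqVneq i j.+1; last by rewrite ZE.
by rewrite htZ ht_son // ltnn.
Qed.

Lemma saturated_chain_sons m (P : dyck m) : saturated_chain (sons P).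
Proof.
apply/andP; split.
  apply/forallP=> x; apply/implyP=> /imsetP[j Pj ->].
  apply/forallP=> y; apply/implyP=> /imsetP[j' Pj' ->].
  by rewrite /Order.comparable !insert_peak_le // leq_total.
apply/forallP=> x; apply/forallP=> y; apply/implyP.
case/and4P=> /imsetP[j Pj ->] /imsetP[j' Pj' ->].
rewrite insert_peak_lt // => ltj'j no_mid.
apply: insert_peak_covered => //; apply/eqP; rewrite eqn_leq ltj'j andbT leqNgt.
(* If [j'.+1 < j], the son with its peak at [j'.+1] lies strictly between the two. *)
apply: contra no_mid => ltj1j; have ltj := ltn_ord j.
have ltj1 : j'.+1 < m.*2.+1 by lia.
have Pj1 : Ordinal ltj1 \in last_descent_points P.
  rewrite mem_last_descent_points /= (dyck_descent_ht (j := j')) //; first by lia.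
  by apply/eqP; rewrite -mem_last_descent_points.
apply/existsP; exists (insert_peak P (Ordinal ltj1)).
by rewrite !insert_peak_lt //= ltj1j ltnSn imset_f.
Qed.

(** * Recovering the path from a son *)

Lemma insert_peak_inj m (P P' : dyck m) (j j' : 'I_(m.*2.+1)) :
  j \in last_descent_points P -> j' \in last_descent_points P' ->
  insert_peak P j = insert_peak P' j' -> P = P'.
Proof.
move=> Pj Pj' eq_sons.
have not_lt (R R' : dyck m) (k k' : 'I_(m.*2.+1)) :
    k \in last_descent_points R -> k' \in last_descent_points R' ->
    insert_peak R k = insert_peak R' k' -> k' <= k.
  move=> Rk Rk' eqRR'; have ltk := ltn_ord k; have ltk' := ltn_ord k'.
  (* At [k'] the right-hand son has height [m.*2 - k']; if [k < k'], the left-hand one would be 2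
     higher. *)
  have := congr1 (fun Q : dyck m.+1 => ht Q k') eqRR'; rewrite !ht_son //; try lia.
  move: Rk'; rewrite leqnn mem_last_descent_points.
  by case: (leqP k' k); lia.
have eq_j : j = j' :> nat.
  apply/eqP; rewrite eqn_leq (not_lt _ _ _ _ Pj' Pj (esym eq_sons)).
  exact: not_lt Pj Pj' eq_sons.
apply: dyck_htP => i lei.
(* Heights of [P] beyond [j] appear in the son shifted by the two steps of the peak. *)
have := congr1 (fun Q : dyck m.+1 => ht Q (if i <= j then i else i.+2)) eq_sons.
rewrite !ht_insert_peak; try by case: ifP; lia.
rewrite -eq_j /insert_peak_fun; case: (leqP i j) => [-> // | ltji].
have -> : (i.+2 <= j) = false by lia.
have -> : (i.+2 == j.+1) = false by lia.
by rewrite subn2.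
Qed.

Lemma dyck_son_of m (Q : dyck m.+1) : exists P : dyck m, Q \in sons P.
Proof.
have exd : exists i, (i <= m.+1.*2) && (ht Q i == m.+1.*2 - i).
  by exists m.+1.*2; rewrite leqnn dyck_htn subnn.
(* The least abscissa [j.+1] on the line [m.+1.*2 - i] is the top of the last peak of [Q]. *)
case: (ex_minnP exd) => -[|j] /andP[lej /eqP htj1] minj.
  by move: htj1; rewrite dyck_ht0 subn0.
have := dyck_step Q lej; rewrite /rise_step /fall_step htj1 => stepj.
(* A fall into [j.+1] would put [j] on the line too, against minimality; hence this step is a
   rise. *)
have nhtj : ht Q j != m.+1.*2 - j.
  by apply: contraTneq (ltnSn j) => htj; rewrite -leqNgt; apply: minj; lia.
have ltj : j < m.*2.+1 by lia.
have htj : ht Q j = m.*2 - j by lia.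
have htj2 : ht Q j.+2 = m.*2 - j.
  by rewrite (dyck_descent_ht (j := j.+1)) //; lia.
(* Deletes the last peak; the two pieces fit together since [htj] and [htj2] give equal heights at
   [j] and [j.+2]. *)
pose h i := if i <= j then ht Q i else ht Q i.+2.
have hD : is_dyck [ffun i : 'I_(m.*2.+1) => h i].
  apply: is_dyck_ffun; rewrite /h; first by rewrite dyck_ht0.
    case: leqP => [lemj | _]; last by rewrite -doubleS dyck_htn.
    by rewrite (_ : m.*2 = j); lia.
  move=> i lti; have := @dyck_step _ Q i; have := @dyck_step _ Q i.+2.
  rewrite /rise_step /fall_step.
  case: (leqP i j); case: (leqP i.+1 j) => ltij leij; try lia.
  by (have -> : i = j by lia); rewrite htj -htj2; lia.
have htP i : i <= m.*2 -> ht (Dyck hD) i = h i by move=> lei; rewrite ht_ffun.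
have Pj : Ordinal ltj \in last_descent_points (Dyck hD).
  by rewrite mem_last_descent_points htP //= /h leqnn htj.
exists (Dyck hD); apply/imsetP; exists (Ordinal ltj) => //.
apply: dyck_htP => i lei; rewrite ht_son //=.
case: (leqP i j) => [leij | ltji]; first by rewrite htP /h ?leij //; lia.
by rewrite (dyck_descent_ht (j := j.+1)) // ltji.
Qed.

Lemma sons_neq0 m (P : dyck m) : sons P != set0.
Proof.
(* The end of the path always belongs to the last descent, even when [m] is 0. *)
apply/set0Pn; exists (insert_peak P ord_max); apply: imset_f.
by rewrite mem_last_descent_points dyck_htn subnn.
Qed.

Lemma mem_sons_inj m (P P' : dyck m) Q : Q \in sons P -> Q \in sons P' -> P = P'.
Proof. by move=> /imsetP[j Pj ->] /imsetP[j' Pj']; exact: insert_peak_inj. Qed.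

(* Here n = m + 1, so that n >= 1 and 2n - 2 = 2m. Injectivity of [sons] makes
   the partition one indexed by the paths P: distinct paths give distinct blocks. *)
Theorem theorem3p1 (m : nat) :
  (forall P : dyck m, saturated_chain (sons P)) /\
  (partition [set sons P | P : dyck m] [set: dyck m.+1] /\
   injective (@sons m)).
Proof.
split; first exact: saturated_chain_sons.
split; last first.
  move=> P P' eq_sons; have /set0Pn[Q QP] := sons_neq0 P.
  by apply: (mem_sons_inj QP); rewrite -eq_sons.
apply/and3P; split.
- rewrite eqEsubset subsetT; apply/subsetP=> Q _; have [P QP] := dyck_son_of Q.
  by apply/bigcupP; exists (sons P) => //; exact: imset_f.
- apply/trivIsetP=> _ _ /imsetP[P _ ->] /imsetP[P' _ ->]; apply: contraR.
  rewrite -setI_eq0 => /set0Pn[Q /setIP[QP QP']].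
  by rewrite (mem_sons_inj QP QP').
by apply/imsetP=> -[P _ /esym/eqP]; rewrite (negPf (sons_neq0 P)).
Qed.
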